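(* For every rational $r$ with $1/2<r\le1$, all (finite or infinite) $J^r$-lists are consistent, i.e. the intersection of all the events in the list is nonempty. In particular, all $J^1$-lists are consistent.
   Context: Let $\Omega_s=\{(a_0a_1a_2\cdots,\,b_0b_1b_2\cdots): a_k,b_k\in\{0,1\}\ \forall k\ge0,\ a_0=b_0\}$, and let $\mathcal{A}_s$ be the $\sigma$-algebra on $\Omega_s$ generated by the sets $[a_k=i]$, $[b_k=i]$ ($k\ge0$, $i\in\{0,1\}$) of states whose $a_k$-th (respectively $b_k$-th) coordinate is $i$. Define $(a,b)\sim_1(a',b')$ iff for all $k\ge1$: $a_k=a'_k$, and $a_k=1$ implies $b_{k-1}=b'_{k-1}$. Define $\sim_2$ analogously by interchanging the roles of the $a$'s and $b$'s. $\Pi_i(w)$ denotes the $\sim_i$-class of $w$. For $w=(a,b)$ let $D_1(w)=\{k-1: k\ge1,\ a_k=0\}$; the map $(a',b')\mapsto(b'_k)_{k\in D_1(w)}$ is a bijection from $\Pi_1(w)$ onto $\{0,1\}^{D_1(w)}$. Let $P_{\Pi_1(w)}$ be the probability measure on $\Pi_1(w)$ obtained by transporting along this bijection the fair-coin product measure on $\{0,1\}^{D_1(w)}$ (the uniform measure if $D_1(w)$ is finite), and put $T_1(w)(E)=P_{\Pi_1(w)}(E\cap\Pi_1(w))$ for $E\in\mathcal{A}_s$. $T_2$ is defined dually by interchanging the $a$'s and $b$'s. Put $B_i^{\ge r}(E)=\{w\in\Omega_s: T_i(w)(E)\ge r\}$. Let $X=[a_0=1]=[b_0=1]$, write $\neg$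 for complement in $\Omega_s$, and for $i=1,2$ define $J_i^rE=B_i^{\ge r}(E)\cup B_i^{\ge r}(\neg E)$ for $E\in\mathcal{A}_s$. Finite $J^r$-lists are lists of events defined inductively: $(X)$ and $(\neg X)$ are $J^r$-lists; if $s$ is a $J^r$-list with last event $s_{last}$ and the outermost operator of $s_{last}$ is $J_1^r$ or $\neg J_1^r$, then $(s,J_2^rs_{last})$ and $(s,\neg J_2^rs_{last})$ are $J^r$-lists; if it is $J_2^r$ or $\neg J_2^r$, then $(s,J_1^rs_{last})$ and $(s,\neg J_1^rs_{last})$ are $J^r$-lists; to the initial lists $(X)$, $(\neg X)$ one may append $J_i^r$ or $\neg J_i^r$ of the last event for either $i$. An infinite $J^r$-list is an infinite list all of whose nonempty finite initial segments are $J^r$-lists. *)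

(* Defs.v *)
From HB Require Import structures.
From mathcomp Require Import all_boot all_order all_algebra.
From mathcomp Require Import all_classical all_reals all_analysis.
From mathcomp Require Import measurable_realfun.

Set Implicit Arguments.
Unset Strict Implicit.
Unset Printing Implicit Defensive.

Import Order.TTheory GRing.Theory Num.Theory.
Import numFieldNormedType.Exports.

Local Open Scope classical_set_scope.
Local Open Scope ring_scope.

Definition coordinate_sets (I : Type) : set (set (I -> bool)) :=
  [set E | exists k b, E = [set c : I -> bool | c k = b]].

(* {0,1}^I with its product sigma-algebra *)
Notation coins I := (g_sigma_algebraType (@coordinate_sets I)).

Definition is_fair_coin (R : realType) (I : eqType) (P : set (coins I) -> \bar R) :=
  forall (F : seq I) (v : I -> bool), uniq F ->
    P [set c | forall k, k \in F -> c k = v k] = (2^-1 ^+ size F)%:E.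

Lemma measurable_coordinate (I : Type) (k : I) (b : bool) :
  measurable [set c : coins I | c k = b].
Proof. by apply: sub_sigma_algebra; exists k, b. Qed.

Lemma measurable_cylinder (I : eqType) (F : seq I) (v : I -> bool) :
  measurable [set c : coins I | forall k, k \in F -> c k = v k].
Proof.
elim: F => [|j F IH].
  by rewrite (_ : [set _ | _] = setT) //; apply/seteqP; split.
rewrite (_ : [set _ | _] = [set c : coins I | c j = v j] `&`
    [set c : coins I | forall k, k \in F -> c k = v k]).
  by apply: measurableI => //; exact: measurable_coordinate.
apply/seteqP; split=> c /=.
  by move=> H; split=> [|k kF]; apply: H; rewrite in_cons ?eqxx ?kF ?orbT.
by move=> [cj cF] k; rewrite in_cons => /orP[/eqP -> //|]; exact: cF.
Qed.

(* A fair-coin measure exists: take the law of the binary digits of a uniform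
   point of [0, 1[ *)
Section fair_coin_existence.
Variable R : realType.

Definition binary_digit (k : nat) (x : R) : bool := odd (Num.truncn (x * 2 ^+ k.+1)).

Fixpoint dyadic (v : nat -> bool) (n : nat) : nat :=
  if n is m.+1 then (v m + (dyadic v m).*2)%N else 0%N.

Lemma truncn_double (y : R) : 0 <= y -> (Num.truncn (y * 2))./2 = Num.truncn y.
Proof.
move=> y0; have y20 : 0 <= y * 2 by rewrite mulr_ge0.
have /andP[lo hi] := truncn_itv y0; have /andP[lo2 hi2] := truncn_itv y20.
move: (Num.truncn (y * 2)) (Num.truncn y) lo hi lo2 hi2 => m n lo hi lo2 hi2.
apply/eqP; rewrite eqn_leq; apply/andP; split.
- rewrite -ltnS ltn_half_double -(ltr_nat R); apply: le_lt_trans lo2 _.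
  by rewrite -muln2 natrM ltr_pM2r.
- rewrite geq_half_double -ltnS -(ltr_nat R); apply: le_lt_trans hi2.
  by rewrite -muln2 natrM ler_pM2r.
Qed.

Lemma binary_digits_dyadic (v : nat -> bool) (n : nat) (x : R) : 0 <= x < 1 ->
  (forall k, (k < n)%N -> binary_digit k x = v k) <->
  Num.truncn (x * 2 ^+ n) = dyadic v n.
Proof.
move=> /andP[x0 x1]; elim: n => [|n IH] /=.
  split=> // _; rewrite expr0 mulr1; apply: truncn_def.
  by rewrite x0 x1.
have /truncn_double : 0 <= x * 2 ^+ n by rewrite mulr_ge0 // exprn_ge0.
rewrite -mulrA -exprSr => half_eq; split.
  move=> H; rewrite -[LHS]odd_double_half half_eq.
  by rewrite (IH.1 (fun k kn => H k (ltnW kn))) -(H n (leqnn _)).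
move=> H.
have On : binary_digit n x = v n.
  by rewrite /binary_digit H oddD odd_double addbF oddb.
have Hn : Num.truncn (x * 2 ^+ n) = dyadic v n.
  by rewrite -half_eq H half_bit_double.
by move=> k; rewrite ltnS leq_eqVlt => /orP[/eqP -> //|]; exact: IH.2.
Qed.

Lemma dyadic_lt (v : nat -> bool) (n : nat) : (dyadic v n < 2 ^ n)%N.
Proof.
elim: n => //= n IH; rewrite expnS mul2n.
rewrite -ltn_double in IH; case: (v n); rewrite ?add0n // add1n.
by rewrite -doubleS leq_double -ltn_double.
Qed.

Let mu := @lebesgue_measure R.

Lemma measurable_truncn_eq (c : R) (n : nat) :
  measurable [set x : R | Num.truncn (x * c) = n].
Proof.
have mle m : measurable [set x : R | (Num.truncn (x * c) <= m)%N].
  rewrite (_ : [set _ | _] = [set x : R | x * c < m.+1%:R]).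
    have mc : measurable_fun [set: R] (fun x : R => x * c).
      exact: mulrr_measurable.
    rewrite (_ : [set _ | _] = setT `&` (fun x : R => x * c) @^-1` `]-oo, m.+1%:R[%classic).
      exact: mc.
    by apply/seteqP; split=> x /=; rewrite in_itv /= => // -[].
  by apply/seteqP; split=> x /=; rewrite truncn_le_nat.
case: n => [|n].
  rewrite (_ : [set _ | _] = [set x : R | (Num.truncn (x * c) <= 0)%N]) //.
  by apply/seteqP; split=> x /=; rewrite leqn0 => /eqP.
rewrite (_ : [set _ | _] = [set x : R | (Num.truncn (x * c) <= n.+1)%N] `\`
                           [set x : R | (Num.truncn (x * c) <= n)%N]).
  exact: measurableD.
apply/seteqP; split=> x /=; first by move=> ->; rewrite ltnn.
by move=> [le1 /negP]; rewrite -ltnNge => le2; apply/eqP; rewrite eqn_leq le1.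
Qed.

Lemma measurable_binary_digit (k : nat) (b : bool) :
  measurable [set x : R | binary_digit k x = b].
Proof.
rewrite (_ : [set _ | _] = \bigcup_(n in [set n | odd n = b])
   [set x : R | Num.truncn (x * 2 ^+ k.+1) = n]).
  by apply: bigcup_measurable => n _; exact: measurable_truncn_eq.
apply/seteqP; split=> x /=; first by move=> H; exists (Num.truncn (x * 2 ^+ k.+1)).
by move=> [n /= nb xn]; rewrite /binary_digit xn.
Qed.

Variables (I : eqType) (g : I -> nat).

Definition binary_digits (x : R) : coins I := fun i => binary_digit (g i) x.

Lemma measurable_binary_digits : measurable_fun [set: R] binary_digits.
Proof.
refine (@measurability _ _ _ (coins I) setT _ (@coordinate_sets I) erefl _).
move=> _ [_ [k [b ->]] <-].
by rewrite setTI; exact: measurable_binary_digit.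
Qed.

Definition unit_itv : set R := `[0, 1[%classic.

Lemma measurable_unit_itv : measurable unit_itv.
Proof. exact: measurable_itv. Qed.

Definition binary_law : set (coins I) -> \bar R :=
  pushforward (mrestr mu measurable_unit_itv) binary_digits.

Let binary_law0 : binary_law set0 = 0%E.
Proof. by rewrite /binary_law /pushforward preimage_set0 measure0. Qed.

Let binary_law_ge0 A : (0 <= binary_law A)%E.
Proof. by rewrite /binary_law /pushforward measure_ge0. Qed.

Let binary_law_sigma_additive : semi_sigma_additive binary_law.
Proof.
have mf A : measurable A -> measurable (binary_digits @^-1` A).
  by move=> mA; rewrite -[X in measurable X]setTI; exact: measurable_binary_digits.
move=> F mF tF mUF; rewrite /binary_law /pushforward preimage_bigcup.
apply: measure_semi_sigma_additive.
- by move=> n; exact: mf.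
- apply/trivIsetP => /= i j _ _ ij; rewrite -preimage_setI.
  by move/trivIsetP : tF => /(_ _ _ _ _ ij) -> //; rewrite preimage_set0.
- by rewrite -preimage_bigcup; exact: mf.
Qed.

HB.instance Definition _ := isMeasure.Build _ _ _ binary_law
  binary_law0 binary_law_ge0 binary_law_sigma_additive.

Lemma binary_law_setT : binary_law setT = 1%E.
Proof.
rewrite /binary_law /pushforward preimage_setT /mrestr setTI /mu.
by rewrite lebesgue_measure_itv /= lte_fin ltr01 oppr0 adde0.
Qed.

HB.instance Definition _ :=
  Measure_isProbability.Build _ _ _ binary_law binary_law_setT.

Lemma lebesgue_all_digits (n : nat) (v : nat -> bool) :
  mu ([set x | forall k, (k < n)%N -> binary_digit k x = v k] `&` unit_itv)
    = (2^-1 ^+ n)%:E.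
Proof.
rewrite (_ : _ `&` _ = `[(dyadic v n)%:R / 2 ^+ n, (dyadic v n).+1%:R / 2 ^+ n[%classic).
  rewrite /mu lebesgue_measure_itv /= lte_fin ltr_pM2r ?invr_gt0 ?exprn_gt0 //.
  by rewrite ltr_nat leqnn -EFinB -mulrBl -natr1 addrAC subrr add0r mul1r exprVn.
have p0 : 0 < 2 ^+ n :> R by rewrite exprn_gt0.
apply/seteqP; split=> x /=; rewrite /unit_itv /= !in_itv /=.
  move=> [H x01]; have /binary_digits_dyadic-/(_ v n)[+ _] := x01.
  move=> /(_ H) <-; rewrite ler_pdivrMr // ltr_pdivlMr //.
  by apply: truncn_itv; case/andP: x01 => x0 _; rewrite mulr_ge0 // ltW.
rewrite ler_pdivrMr // ltr_pdivlMr // => xd.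
have x01 : 0 <= x < 1.
  case/andP: xd => lo hi; apply/andP; split.
    by rewrite -(@pmulr_lge0 _ (2 ^+ n)) // (le_trans _ lo).
  rewrite -(@ltr_pM2r _ (2 ^+ n)) // mul1r (lt_le_trans hi) //.
  by rewrite -natrX ler_nat dyadic_lt.
by split=> //; apply/(binary_digits_dyadic v n x01); exact: truncn_def.
Qed.

Lemma measurable_digits (F : seq nat) (v : nat -> bool) :
  measurable [set x : R | forall k, k \in F -> binary_digit k x = v k].
Proof.
elim: F => [|j F IH].
  by rewrite (_ : [set _ | _] = setT) //; apply/seteqP; split.
rewrite (_ : [set _ | _] = [set x : R | binary_digit j x = v j] `&`
    [set x : R | forall k, k \in F -> binary_digit k x = v k]).
  by apply: measurableI => //; exact: measurable_binary_digit.
apply/seteqP; split=> c /=.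
  by move=> H; split=> [|k kF]; apply: H; rewrite in_cons ?eqxx ?kF ?orbT.
by move=> [cj cF] k; rewrite in_cons => /orP[/eqP -> //|]; exact: cF.
Qed.

Lemma lebesgue_some_digits (n : nat) (F : seq nat) (v : nat -> bool) :
  uniq F -> (forall k, k \in F -> (k < n)%N) ->
  mu ([set x | forall k, k \in F -> binary_digit k x = v k] `&` unit_itv)
    = (2^-1 ^+ size F)%:E.
Proof.
move=> uF Fn; have sF : (size F <= n)%N.
  rewrite -[leqRHS](size_iota 0) uniq_leq_size // => k /Fn.
  by rewrite mem_iota.
elim: {sF}(n - size F)%N {-2}F (subnKC sF) uF Fn v => [|m IH] {}F.
  rewrite addn0 => sF uF Fn v.
  have sub : {subset F <= iota 0 n} by move=> j /Fn; rewrite mem_iota.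
  have FE k : (k \in F) = (k < n)%N.
    have le_sz : (size (iota 0 n) <= size F)%N by rewrite size_iota sF.
    by have [_ ->] := uniq_min_size uF sub le_sz; rewrite mem_iota.
  rewrite sF -(lebesgue_all_digits n v); congr (mu (_ `&` _)).
  by apply/seteqP; split=> x /= H k; [rewrite -FE|rewrite FE]; exact: H.
move=> sF uF Fn v.
have [j [jn jF]] : exists j, (j < n)%N /\ j \notin F.
  apply: contrapT => /forallNP none.
  have : (size (iota 0 n) <= size F)%N.
    apply: uniq_leq_size; first exact: iota_uniq.
    move=> j; rewrite mem_iota /= => jn.
    by apply: contrapT => /negP jF; exact: (none j).
  by rewrite size_iota -sF -{2}[size F]addn0 leq_add2l.
pose w b k := if k == j then b else v k.
have wj b : w b j = b by rewrite /w eqxx.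
have wF b k : k \in F -> w b k = v k.
  by move=> kF; rewrite /w; case: eqP => // kj; move: jF; rewrite -kj kF.
have step b : mu ([set x | forall k, k \in j :: F -> binary_digit k x = w b k]
     `&` unit_itv) = (2^-1 ^+ (size F).+1)%:E.
  apply: IH; rewrite /= ?jF //; first by rewrite addSnnS.
  by move=> k; rewrite in_cons => /orP[/eqP -> //|]; exact: Fn.
rewrite (_ : _ `&` _ =
  ([set x | forall k, k \in j :: F -> binary_digit k x = w true k] `&` unit_itv) `|`
  ([set x | forall k, k \in j :: F -> binary_digit k x = w false k] `&` unit_itv)).
  rewrite /mu measureU; last 3 first.
  - by apply: measurableI; [exact: measurable_digits|exact: measurable_unit_itv].
  - by apply: measurableI; [exact: measurable_digits|exact: measurable_unit_itv].
  - apply/seteqP; split=> // x /= [[+ _] [+ _]] => /(_ j (mem_head _ _)) + /(_ j (mem_head _ _)).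
    by rewrite !wj => ->.
  transitivity ((2^-1 ^+ (size F).+1)%:E + (2^-1 ^+ (size F).+1)%:E : \bar R)%E.
    by congr (_ + _)%E; exact: step.
  have half2 : 2^-1 + 2^-1 = 1 :> R by rewrite [RHS]splitr div1r.
  by rewrite -EFinD exprS -mulrDl half2 mul1r.
apply/seteqP; split=> x /=.
  move=> [H x01]; case: (boolP (binary_digit j x)) => dj; [left|right]; split=> //.
    move=> k; rewrite in_cons; have [-> _|kj /= kF] := eqVneq k j; first by rewrite wj.
    by rewrite wF // H.
  move=> k; rewrite in_cons; have [-> _|kj /= kF] := eqVneq k j.
    by rewrite wj; exact/negbTE.
  by rewrite wF // H.
by move=> [] [H x01]; split=> // k kF; rewrite H ?in_cons ?kF ?orbT // wF.
Qed.

Lemma binary_law_fair_coin : injective g -> is_fair_coin binary_law.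
Proof.
move=> g_inj F v uF.
have [n Fn] : exists n, forall k, k \in map g F -> (k < n)%N.
  exists (\max_(k <- map g F) k).+1 => k kF; rewrite ltnS.
  by rewrite (big_rem k) //= leq_maxl.
pose w k := if [pick i : 'I_(size F) | g (tnth (in_tuple F) i) == k] is Some i
            then v (tnth (in_tuple F) i) else false.
have wE i : i \in F -> w (g i) = v i.
  move=> iF; rewrite /w; case: pickP => [j /eqP/g_inj -> //|none].
  have /tnthP[j ij] : i \in in_tuple F by [].
  by have := none j; rewrite -ij eqxx.
rewrite -(size_map g) -(@lebesgue_some_digits n _ w) ?map_inj_uniq //.
rewrite /binary_law /pushforward /mrestr; congr (mu (_ `&` _)).
apply/seteqP; split=> x /=.
  by move=> H _ /mapP[i iF ->]; rewrite wE // -H.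
by move=> H i iF; rewrite -wE // -H // map_f.
Qed.

End fair_coin_existence.

Lemma fair_coin_exists (R : realType) (D : set nat) :
  exists P : probability (coins D) R, is_fair_coin P.
Proof.
exists (binary_law R (@set_val _ D) : probability _ _).
by apply: binary_law_fair_coin; exact: val_inj.
Qed.

(* The fair-coin product measure on {0,1}^D; being a probability on the
   sigma-algebra generated by the coordinates, it is determined there by
   fair_coinP. *)
Definition fair_coin (R : realType) (D : set nat) : probability (coins D) R :=
  projT1 (cid (fair_coin_exists R D)).

Lemma fair_coinP (R : realType) (D : set nat) : is_fair_coin (fair_coin R D).
Proof. exact: (projT2 (cid (fair_coin_exists R D))). Qed.

Definition state : Type :=
  {w : (nat -> bool) * (nat -> bool) | w.1 0%N == w.2 0%N}.

HB.instance Definition _ := Choice.on state.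
HB.instance Definition _ := isPointed.Build state
  (exist _ ((fun=> false), (fun=> false)) (eqxx false)).

Inductive agent := agent1 | agent2.

Definition other (i : agent) : agent := if i is agent1 then agent2 else agent1.

(* w = (a, b): agent1 owns the a's and agent2 the b's *)
Definition coord (i : agent) (w : state) (k : nat) : bool :=
  if i is agent1 then (val w).1 k else (val w).2 k.

Definition A_s_generators : set (set state) :=
  [set E | exists i k b, E = [set w | coord i w k = b]].

(* the measurable space (Omega_s, A_s) *)
Notation Omega_s := (g_sigma_algebraType A_s_generators).

Definition sim (i : agent) (w w' : state) : Prop :=
  forall k, (1 <= k)%N ->
    coord i w k = coord i w' k /\
    (coord i w k = true -> coord (other i) w k.-1 = coord (other i) w' k.-1).

Definition Pi (i : agent) (w : state) : set state := [set w' | sim i w w'].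

Definition D (i : agent) (w : state) : set nat :=
  [set k.-1 | k in [set k | (1 <= k)%N /\ coord i w k = false]].

Definition restr (i : agent) (w : state) (w' : state) : coins (D i w) :=
  fun k => coord (other i) w' (val k).

Lemma DE i w k : D i w k <-> coord i w k.+1 = false.
Proof. by split=> [[[//|j] [_ ?] <-]|H] //; exists k.+1. Qed.

Lemma other_other i : other (other i) = i.
Proof. by case: i. Qed.

Lemma coord0 i w : coord i w 0 = coord (other i) w 0.
Proof. by case: i; rewrite /coord /= (eqP (valP w)). Qed.

Lemma state_eq i w w' : coord i w =1 coord i w' ->
  coord (other i) w =1 coord (other i) w' -> w = w'.
Proof.
move=> /funext e1 /funext e2; apply: val_inj.
rewrite [LHS]surjective_pairing [RHS]surjective_pairing.
by case: i e1 e2 => /= e1 e2; congr pair.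
Qed.

Definition mk_state (i : agent) (s t : nat -> bool) (st : s 0%N = t 0%N) : state :=
  if i is agent1 then exist _ (s, t) (introT eqP st)
  else exist _ (t, s) (introT eqP (esym st)).

Lemma coord_mk_state i s t st k : coord i (@mk_state i s t st) k = s k.
Proof. by case: i. Qed.

Lemma coord_other_mk_state i s t st k :
  coord (other i) (@mk_state i s t st) k = t k.
Proof. by case: i. Qed.

Lemma measurable_state (i : agent) (k : nat) (b : bool) :
  measurable [set w : Omega_s | coord i w k = b].
Proof. by apply: sub_sigma_algebra; exists i, k, b. Qed.

Section restr_inverse.
Variables (i : agent) (w : state).
Implicit Type c : coins (D i w).

Let glue_other c (k : nat) : bool :=
  if insub k is Some k' then c k' else coord (other i) w k.

Let glue_own c (k : nat) : bool :=
  if k is 0 then glue_other c 0 else coord i w k.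

Definition glue c : state := @mk_state i (glue_own c) (glue_other c) erefl.

Let glueD c (k : D i w) : coord (other i) (glue c) (val k) = c k.
Proof. by rewrite coord_other_mk_state /glue_other valK. Qed.

Let glueN c (k : nat) : ~ D i w k ->
  coord (other i) (glue c) k = coord (other i) w k.
Proof.
by move=> kD; rewrite coord_other_mk_state /glue_other insubN //; apply/negP => /set_mem.
Qed.

Let glueS c (k : nat) : coord i (glue c) k.+1 = coord i w k.+1.
Proof. by rewrite coord_mk_state. Qed.

Lemma restr_glue c : restr (glue c) = c.
Proof. by apply/funext => k; rewrite /restr glueD. Qed.

Lemma glue_Pi c : Pi i w (glue c).
Proof.
move=> [//|k] _; rewrite glueS; split=> //= wk; rewrite glueN //.
by rewrite DE wk.
Qed.

Lemma glue_restr w' : Pi i w w' -> glue (@restr i w w') = w'.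
Proof.
move=> ww'; have eq_other k :
    coord (other i) (glue (@restr i w w')) k = coord (other i) w' k.
  have [kD|kD] := pselect (D i w k).
    by rewrite -[k in LHS](@SubK _ _ (D i w) k (mem_set kD)) glueD /restr SubK.
  rewrite glueN //; apply: (ww' k.+1 isT).2.
  by apply/negPn/negP => /negbTE /DE.
apply: (@state_eq i) => // -[|k]; first by rewrite !(coord0 i) eq_other.
by rewrite glueS (ww' k.+1 isT).1.
Qed.

Lemma restr_bij : set_bij (Pi i w) setT (@restr i w).
Proof.
split=> //.
- by move=> u v /set_mem uP /set_mem vP uv; rewrite -(glue_restr uP) uv glue_restr.
- by move=> c _; exists (glue c); [exact: glue_Pi|exact: restr_glue].
Qed.

Lemma restr_image (E : set state) : @restr i w @` (E `&` Pi i w) = glue @^-1` E.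
Proof.
apply/seteqP; split=> [_ [w' [Ew' ww'] <-]|c Ec] /=; first by rewrite glue_restr.
by exists (glue c); [split=> //; exact: glue_Pi|exact: restr_glue].
Qed.

Lemma measurable_glue : measurable_fun [set: coins (D i w)] (glue : _ -> Omega_s).
Proof.
refine (@measurability _ _ _ Omega_s setT _ A_s_generators erefl _).
have mother k b : measurable [set c | coord (other i) (glue c) k = b].
  have [kD|kD] := pselect (D i w k).
    rewrite (_ : [set _ | _] = [set c : coins (D i w) | c (SigSub (mem_set kD)) = b]).
      exact: measurable_coordinate.
    by apply/seteqP; split=> c /=; rewrite -(glueD c (SigSub (mem_set kD))).
  rewrite (_ : [set _ | _] = [set _ | coord (other i) w k = b]).
    by have [e|e] := pselect (coord (other i) w k = b);
      [rewrite (_ : [set _ | _] = setT)|rewrite (_ : [set _ | _] = set0)] => //;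
      apply/seteqP; split.
  by apply/seteqP; split=> c /=; rewrite glueN.
have mown k b : measurable [set c | coord i (glue c) k = b].
  case: k => [|k].
    rewrite (_ : [set _ | _] = [set c | coord (other i) (glue c) 0%N = b]) //.
    by apply/seteqP; split=> c /=; rewrite (coord0 i).
  by have [e|e] := pselect (coord i w k.+1 = b);
      [rewrite (_ : [set _ | _] = setT)|rewrite (_ : [set _ | _] = set0)] => //;
      apply/seteqP; split=> c //=; rewrite glueS.
move=> _ [_ [j [k [b ->]]] <-]; rewrite setTI /preimage /=.
have [->|->] : j = i \/ j = other i by case: (i) (j) => -[]; auto.
- exact: mown.
- exact: mother.
Qed.

End restr_inverse.

Section type_function.
Variable R : realType.

Definition T (i : agent) (w : state) : set Omega_s -> \bar R :=
  fun E => fair_coin R (D i w) (@restr i w @` (E `&` Pi i w)).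

Let T_glue i w E : T i w E = fair_coin R (D i w) (@glue i w @^-1` E).
Proof. by rewrite /T restr_image. Qed.

Let T0 i w : T i w set0 = 0%E.
Proof. by rewrite T_glue preimage_set0 measure0. Qed.

Let T_ge0 i w E : (0 <= T i w E)%E.
Proof. exact: measure_ge0. Qed.

Let T_sigma_additive i w : semi_sigma_additive (T i w).
Proof.
have mf A : measurable A -> measurable ((@glue i w : _ -> Omega_s) @^-1` A).
  by move=> mA; rewrite -[X in measurable X]setTI; exact: measurable_glue.
move=> F mF tF mUF; rewrite T_glue preimage_bigcup.
rewrite (_ : (fun n => _) = fun n =>
    (\sum_(0 <= k < n) fair_coin R (D i w) (@glue i w @^-1` F k))%E); last first.
  by apply/funext => n; apply: eq_bigr => k _; rewrite T_glue.
apply: measure_semi_sigma_additive.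
- by move=> n; exact: mf.
- apply/trivIsetP => /= a b _ _ ab; rewrite -preimage_setI.
  by move/trivIsetP : tF => /(_ _ _ _ _ ab) -> //; rewrite preimage_set0.
- by rewrite -preimage_bigcup; exact: mf.
Qed.

HB.instance Definition _ i w := isMeasure.Build _ _ _ (T i w)
  (T0 i w) (T_ge0 i w) (@T_sigma_additive i w).

Let T_setT i w : T i w setT = 1%E.
Proof. by rewrite T_glue preimage_setT probability_setT. Qed.

HB.instance Definition _ i w :=
  Measure_isProbability.Build _ _ _ (T i w) (T_setT i w).

Definition B (i : agent) (r : rat) (E : set state) : set state :=
  [set w | ((ratr r)%:E <= T i w E)%E].

Definition J (i : agent) (r : rat) (E : set state) : set state :=
  B i r E `|` B i r (~` E).

End type_function.

(* The rules for extending a list look at the outermost operator of its last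
   event, so the entries of a list are expressions, interpreted by [event]. *)
Inductive expr := EX | ENot of expr | EJ of agent & expr.

Fixpoint event (R : realType) (r : rat) (e : expr) : set state :=
  match e with
  | EX => [set w | coord agent1 w 0 = true]
  | ENot e => ~` event R r e
  | EJ i e => J R i r (event R r e)
  end.

(* J i and ~ J i both have outermost agent i; X and ~ X have none *)
Fixpoint outermost (e : expr) : option agent :=
  match e with
  | EX => None
  | ENot e => outermost e
  | EJ i _ => Some i
  end.

Inductive Jlist : seq expr -> Prop :=
| Jlist_X : Jlist [:: EX]
| Jlist_notX : Jlist [:: ENot EX]
| Jlist_J s last i : Jlist (rcons s last) -> outermost last <> Some i ->
    Jlist (rcons (rcons s last) (EJ i last))
| Jlist_notJ s last i : Jlist (rcons s last) -> outermost last <> Some i ->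
    Jlist (rcons (rcons s last) (ENot (EJ i last))).

Definition infinite_Jlist (u : nat -> expr) : Prop :=
  forall n, Jlist (mkseq u n.+1).

Definition consistent (R : realType) (r : rat) (s : seq expr) : Prop :=
  \bigcap_(k in [set k | (k < size s)%N]) event R r (nth EX s k) !=set0.

Definition infinite_consistent (R : realType) (r : rat) (u : nat -> expr) : Prop :=
  \bigcap_k event R r (u k) !=set0.

Definition all_Jlists_consistent (R : realType) (r : rat) : Prop :=
  (forall s, Jlist s -> consistent R r s) /\
  (forall u, infinite_Jlist u -> infinite_consistent R r u).

(* Main.v *)
Require Import Defs.
From mathcomp Require Import all_boot all_order all_algebra.
From mathcomp Require Import all_classical all_reals all_analysis.

Set Implicit Arguments.
Unset Strict Implicit.
Unset Printing Implicit Defensive.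

Import Order.TTheory GRing.Theory Num.Theory.

Local Open Scope ring_scope.

(** Fix [1/2 < r <= 1] and consider the event that coordinate [k] of the other
    agent has a given value.  If coordinate [k.+1] of agent [i] is 1, agent [i]
    sees that coordinate, so the event has probability 0 or 1 for [i].  If it is
    0, that coordinate is a fair coin for [i], and both the event and its
    complement have probability 1/2, below [r].  Hence [J i r] turns the event into
    [[set w | coord i w k.+1 = true]] ([J_coordinate]).

    Since [X] reads the common coordinate 0 and consecutive operators in a list
    belong to different agents, the [k]-th event of a list prescribes the value
    of coordinate [k] of one of the two agents, and no list prescribes two values
    at the same index ([Jlist_prescribes]).  So the prescribed values form a
    single sequence [v], and the state [(v, v)] satisfies the whole list,
    whichever agents the list refers to ([prescribed_consistent]). *)

(* [coord] and [glue] below are those of states, not those of vector spaces and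
   of functions on sets. *)
Import Defs.

Local Open Scope classical_set_scope.

Section justified_coordinate.
Variables (R : realType) (i : agent).

Lemma T_certain (w : state) (E : set state) : Pi i w `<=` E -> T R i w E = 1%E.
Proof.
move=> PiE; have <- : T R i w setT = 1%E by exact: probability_setT.
by rewrite /T (setIidr PiE) setTI.
Qed.

(** Inside [Pi i w] the event fixes exactly one toss of the fair coin, the one at
    index [k]. *)
Lemma T_hidden_coordinate (w : state) (k : nat) (b : bool) :
  coord i w k.+1 = false ->
  T R i w [set w' | coord (other i) w' k = b] = (2^-1)%:E.
Proof.
move=> /DE kD; pose k' : D i w := SigSub (mem_set kD).
rewrite /T (_ : _ @` _ = [set c | forall j, j \in [:: k'] -> c j = b]).
  by rewrite (@fair_coinP R (D i w) _ (fun=> b)) // expr1.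
apply/seteqP; split=> [_ [w' [w'b _] <-] j|c cb] /=.
  by rewrite inE => /eqP ->.
exists (glue c); last exact: restr_glue.
split; last exact: glue_Pi.
by rewrite /= -(cb k' (mem_head _ _)) -[in RHS](restr_glue c).
Qed.

Lemma setC_coordinate (j : agent) (k : nat) (b : bool) :
  ~` [set w | coord j w k = b] = [set w | coord j w k = ~~ b].
Proof.
by apply/seteqP; split=> w /=; case: (coord j w k); case: b => // H; case: H.
Qed.

(** An agent is certain of a seen coordinate and finds either value of a hidden
    one as likely as the other, so a threshold above one half separates the two
    cases, and it does so whatever the value [b] is. *)
Lemma J_coordinate (r : rat) (k : nat) (b : bool) : 1 / 2 < r -> r <= 1 ->
  J R i r [set w | coord (other i) w k = b] = [set w | coord i w k.+1 = true].
Proof.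
move=> r_gt r_le; rewrite /J setC_coordinate.
have hidden w c : coord i w k.+1 = false ->
    ~ B R i r [set w' | coord (other i) w' k = c] w.
  move=> wk; rewrite /B /= T_hidden_coordinate // lee_fin.
  apply/negP; rewrite -ltNge.
  by rewrite -(ratr_nat R 2) -fmorphV /= ltr_rat -div1r.
have seen w : coord i w k.+1 = true ->
    B R i r [set w' | coord (other i) w' k = coord (other i) w k] w.
  move=> wk; rewrite /B /= T_certain.
    by rewrite lee_fin -[leRHS](rmorph1 (@ratr R)) ler_rat.
  by move=> w' /(_ k.+1 isT) [_ /(_ wk)].
apply/seteqP; split=> w /=.
  by case: (boolP (coord i w k.+1)) => // /negbTE wk [] /(hidden _ _ wk).
by move=> /seen; case: (coord _ w k) (b) => -[]; [left|right|right|left].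
Qed.

End justified_coordinate.

Section lists.
Variables (R : realType) (r : rat).
Hypotheses (r_gt : 1 / 2 < r) (r_le : r <= 1).

(** Quantifying over the agents [i] that may act next treats the base events,
    which read the coordinate 0 shared by both agents, together with the events
    [J i r E], which read a coordinate of [i]. *)
Definition prescribes (k : nat) (b : bool) (e : expr) : Prop :=
  forall i, outermost e <> Some i ->
    event R r e = [set w | coord (other i) w k = b].

Lemma prescribes_X : prescribes 0 true EX.
Proof.
case=> _ //; transitivity [set w | coord agent1 w 0 = true] => //.
by apply/seteqP; split=> w /=; rewrite (eqP (valP w)).
Qed.

Lemma prescribes_not k b e : prescribes k b e -> prescribes k (~~ b) (ENot e).
Proof. by move=> He i ei; rewrite /= (He i ei) setC_coordinate. Qed.

Lemma prescribes_J k b e i : outermost e <> Some i ->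
  prescribes k b e -> prescribes k.+1 true (EJ i e).
Proof.
move=> ei He j /= ij; rewrite (He i ei) J_coordinate //.
by rewrite (_ : other j = i) //; case: i j ij {ei} => -[].
Qed.

(** Each entry wraps one more [EJ] around its predecessor, which raises the index
    of the prescribed coordinate by one, while [ENot] only flips the value. *)
Lemma Jlist_prescribes s : Jlist s ->
  forall k, (k < size s)%N -> exists b, prescribes k b (nth EX s k).
Proof.
have extend s' e : (forall k, (k < size s')%N ->
        exists b, prescribes k b (nth EX s' k)) ->
    (exists b, prescribes (size s') b e) ->
    forall k, (k < size (rcons s' e))%N ->
      exists b, prescribes k b (nth EX (rcons s' e) k).
  move=> Hs' He k; rewrite size_rcons ltnS leq_eqVlt nth_rcons.
  by move=> /orP[/eqP ->|ks]; [rewrite ltnn eqxx | rewrite ks; exact: Hs'].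
have last_entry s' e : (forall k, (k < size (rcons s' e))%N ->
        exists b, prescribes k b (nth EX (rcons s' e) k)) ->
    exists b, prescribes (size s') b e.
  move=> /(_ (size s')); rewrite size_rcons leqnn nth_rcons ltnn eqxx.
  exact.
elim=> {s} [||s e i _ IH ei|s e i _ IH ei].
- by case=> // _; exists true; exact: prescribes_X.
- by case=> // _; exists false; exact: (prescribes_not prescribes_X).
- apply: extend => //; have [b eb] := last_entry _ _ IH.
  by exists true; rewrite size_rcons; exact: prescribes_J eb.
- apply: extend => //; have [b eb] := last_entry _ _ IH.
  exists false; rewrite size_rcons.
  by apply: (@prescribes_not _ true); exact: prescribes_J eb.
Qed.

(** Events at distinct positions prescribe values at distinct indices, so no two
    of them conflict.  Giving both agents the same sequence makes the choice of the agent
    irrelevant and respects the constraint that they share coordinate 0. *)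
Lemma prescribed_consistent (K : set nat) (u : nat -> expr) :
  (forall k, K k -> exists b, prescribes k b (u k)) ->
  \bigcap_(k in K) event R r (u k) !=set0.
Proof.
move=> Hu.
have /choice[v Hv] k : exists b, K k -> prescribes k b (u k).
  by have [/Hu[b ?]|?] := pselect (K k); [exists b | exists true].
exists (@mk_state agent1 v v erefl) => k Kk.
have [i ui] : exists i, outermost (u k) <> Some i.
  by case: (outermost (u k)) => [[]|]; [exists agent2|exists agent1|exists agent1].
by rewrite (Hv k Kk i ui); case: i {ui}.
Qed.

Lemma Jlists_consistent : all_Jlists_consistent R r.
Proof.
split=> [s /Jlist_prescribes Hs|u Hu]; apply: prescribed_consistent => //.
move=> k _; have := Jlist_prescribes (Hu k) (k := k).
by rewrite size_mkseq nth_mkseq //; exact.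
Qed.

End lists.

Local Close Scope classical_set_scope.

Theorem theorem3p37 (R : realType) :
  (forall r : rat, 1 / 2 < r -> r <= 1 -> all_Jlists_consistent R r) /\
  all_Jlists_consistent R 1.
Proof. by split; [exact: Jlists_consistent | exact: Jlists_consistent]. Qed.
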